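(* Let $P$ be a non-empty finite set of primes, let $q$ be the minimum element of $P$, and let $Q\in P$ be an element with maximum value of $\|Q\|_{\log}$ among elements of $P$. Then for all integers $n>1$, \[\|n\|_{P,\log} \leq \|Q\|_{\log} + \frac{q-1}{\log_3 q}.\]
   Context: For a positive integer $m$, $\|m\|$ denotes the minimum number of occurrences of the constant $1$ in an arithmetic expression built only from the constant $1$, addition, multiplication and parentheses whose value is $m$; for $m>1$, $\|m\|_{\log}=\|m\|/\log_3 m$. Given a non-empty finite set $P$ of primes, the $P$-algorithm builds an expression for $n>0$ as follows: (1) if $n=1$, represent $n$ as $1$ and stop; (2) if $n=p\in P$, represent $n$ by a shortest expression of $p$ (with $\|p\|$ ones) and stop; (3) if $n>1$, $n\notin P$ and $n$ is divisible by some $p\in P$, represent $n$ as (shortest expression of $p$)$\cdot\frac{n}{p}$ and continue with $\frac{n}{p}$; (4) if $n>1$ and $n$ is divisible by no $p\in P$, represent $n$ as $1+(n-1)$ and continue with $n-1$. The number of ones in the resulting expression does not depend on the choices made in step (3); it is denoted $\|n\|_P$. Equivalently: $\|1\|_P=1$; $\|p\|_P=\|p\|$ for $p\in P$; $\|n\|_P=\|p\|+\|n/p\|_P$ if $n>1$, $n\notin P$, $p\in P$, $p\mid n$; $\|n\|_P = 1+\|n-1\|_P$ if $n>1$ is divisible by no element of $P$. For $n>1$, $\|n\|_{P,\log}=\|n\|_P/\log_3 n$. *)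

(* Defs.v *)
From HB Require Import structures.
From mathcomp Require Import all_boot all_order all_algebra finmap.
From mathcomp Require Import all_classical all_reals exp.
Set Implicit Arguments.
Unset Strict Implicit.
Unset Printing Implicit Defensive.
Import Order.TTheory GRing.Theory Num.Theory.
Local Open Scope nat_scope.

Inductive expr : Type :=
| One
| Add of expr & expr
| Mul of expr & expr.

Fixpoint value (e : expr) : nat :=
  match e with
  | One => 1
  | Add e1 e2 => value e1 + value e2
  | Mul e1 e2 => value e1 * value e2
  end.

Fixpoint ones (e : expr) : nat :=
  match e with
  | One => 1
  | Add e1 e2 | Mul e1 e2 => ones e1 + ones e2
  end.

Definition shortest (m : nat) (e : expr) : Prop :=
  value e = m /\ forall e', value e' = m -> ones e <= ones e'.

(* ||m||; the default 0 is only reached for m = 0, see [complexity_spec] *)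
Definition complexity (m : nat) : nat :=
  xget 0 [set k | exists2 e, shortest m e & ones e = k]%classic.

(* [P_alg P n e]: some run of the P-algorithm on n outputs e; the choice of
   the divisor p \in P and of the shortest expressions is left free *)
Inductive P_alg (P : {fset nat}) : nat -> expr -> Prop :=
| P_alg_one : P_alg P 1 One
| P_alg_mem (p : nat) e : p \in P -> shortest p e -> P_alg P p e
| P_alg_div n (p : nat) e e' :
    1 < n -> n \notin P -> p \in P -> p %| n ->
    shortest p e -> P_alg P (n %/ p) e' -> P_alg P n (Mul e e')
| P_alg_sub n e :
    1 < n -> (forall p : nat, p \in P -> ~~ (p %| n)) ->
    P_alg P n.-1 e -> P_alg P n (Add One e).

(* ||n||_P; [P_complexity_spec] shows that this is well defined for n > 0
   when P consists of primes *)
Definition P_complexity (P : {fset nat}) (n : nat) : nat :=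
  xget 0 [set k | exists2 e, P_alg P n e & ones e = k]%classic.

Definition log3 (R : realType) (x : R) : R := (ln x / ln 3)%R.

Definition complexity_log (R : realType) (m : nat) : R :=
  ((complexity m)%:R / log3 m%:R)%R.

Definition P_complexity_log (R : realType) (P : {fset nat}) (n : nat) : R :=
  ((P_complexity P n)%:R / log3 n%:R)%R.

Lemma shortest_exists m : 0 < m -> exists e, shortest m e.
Proof.
move=> m_gt0; have [e0 e0m] : exists e, value e = m.
  elim: m m_gt0 => // -[|m] IH _; first by exists One.
  by have [//|e em] := IH; exists (Add One e); rewrite /= em.
have exk : exists k, `[< exists2 e, value e = m & ones e = k >].
  by exists (ones e0); apply/asboolP; exists e0.
case: (ex_minnP exk) => k /asboolP[e em ek] mink; exists e; split=> // e' e'm.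
by rewrite ek; apply: mink; apply/asboolP; exists e'.
Qed.

Lemma shortest_ones m e : shortest m e -> ones e = complexity m.
Proof.
move=> [em emin]; apply/esym/xget_unique; first by exists e.
move=> k [e' [e'm e'min]] <-.
by apply/eqP; rewrite eqn_leq e'min // emin.
Qed.

Lemma complexity_spec m : 0 < m ->
  (exists2 e, value e = m & ones e = complexity m) /\
  (forall e, value e = m -> complexity m <= ones e).
Proof.
move=> /shortest_exists[e em]; rewrite -(shortest_ones em).
by case: em => em emin; split=> //; exists e.
Qed.

Section WellDefined.
Variable P : {fset nat}.
Hypothesis primeP : forall p : nat, p \in P -> prime p.

Lemma P_alg_exists n : 0 < n -> exists e, P_alg P n e.
Proof.
elim/ltn_ind: n => n IH n_gt0.
have [nP|nP] := boolP (n \in P).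
  by have [e ne] := shortest_exists n_gt0; exists e; apply: P_alg_mem.
have [->|n_neq1] := eqVneq n 1; first by exists One; constructor.
have n_gt1 : 1 < n by rewrite ltn_neqAle eq_sym n_neq1.
have [[p [pP pn]]|npP] := pselect (exists p, p \in P /\ p %| n).
  have p_gt1 := prime_gt1 (primeP pP); have p_gt0 := ltnW p_gt1.
  have [e pe] := shortest_exists p_gt0.
  have [||e' ne'] := IH (n %/ p); [exact: ltn_Pdiv|by rewrite divn_gt0 // dvdn_leq|].
  by exists (Mul e e'); apply: (P_alg_div n_gt1 nP pP).
have [||e ne] := IH n.-1; [by rewrite prednK|by case: n n_gt1 {IH n_gt0 nP n_neq1 npP} => [|[]]|].
exists (Add One e); apply: P_alg_sub => // p pP.
by apply/negP => pn; apply: npP; exists p.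
Qed.

Lemma P_alg_value n e : P_alg P n e -> value e = n.
Proof.
elim=> {n e} [|p e _ []|n p e e' _ _ _ pn [ep _] _ IH|n e n1 _ _ IH] //=.
  by rewrite ep IH mulnC divnK.
by rewrite IH add1n prednK // ltnW.
Qed.

Lemma P_alg_ones n e1 e2 : P_alg P n e1 -> P_alg P n e2 -> ones e1 = ones e2.
Proof.
have N1 : 1 \notin P by apply/negP => /primeP.
elim/ltn_ind: n e1 e2 => n IH e1 e2 r1 r2.
case: r1 IH r2 => {n e1} [|n e nP sn|n p e e' n1 nP pP pn se r1|n e n1 nd r1] IH r2.
- inversion r2; subst => //; first by rewrite H in N1.
- inversion r2; subst; first by rewrite nP in N1.
  + by rewrite (shortest_ones sn) (shortest_ones H0).
  + by rewrite nP in H0.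
  + by have := H0 _ nP; rewrite dvdnn.
- have pp := primeP pP; have p_gt0 := prime_gt0 pp.
  inversion r2; subst => //; first by rewrite H in nP.
    rename p0 into p', H1 into p'P, H2 into p'n, H3 into se', H4 into r2'.
    have pp' := primeP p'P; have p'_gt0 := prime_gt0 pp'.
    rewrite /= (shortest_ones se) (shortest_ones se').
    have [epp'|npp'] := eqVneq p p'.
      by subst p'; congr (_ + _); apply: IH r1 r2'; rewrite ltn_Pdiv ?prime_gt1 // ltnW.
    have pcop : coprime p p' by rewrite prime_coprime // dvdn_prime2.
    have /dvdnP[m En] : p * p' %| n by rewrite Gauss_dvd // pn.
    have m_gt0 : 0 < m by case: m En n1 => // ->.
    have En1 : n %/ p = m * p' by rewrite En mulnCA mulKn // mulnC.
    have En2 : n %/ p' = m * p by rewrite En mulnA mulnK.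
    have lt1 : n %/ p < n by rewrite ltn_Pdiv ?prime_gt1 // ltnW.
    have lt2 : n %/ p' < n by rewrite ltn_Pdiv ?prime_gt1 // ltnW.
    have [m1|m_neq1] := eqVneq m 1.
      rewrite m1 mul1n in En1; rewrite m1 mul1n in En2.
      rewrite En1 in r1 lt1; rewrite En2 in r2' lt2.
      rewrite (IH _ lt1 _ _ r1 (P_alg_mem p'P se')).
      rewrite (IH _ lt2 _ _ r2' (P_alg_mem pP se)).
      by rewrite (shortest_ones se) (shortest_ones se') addnC.
    have m_gt1 : 1 < m by rewrite ltn_neqAle eq_sym m_neq1.
    have mulNP r : prime r -> (m * r \notin P) * (1 < m * r).
      move=> pr; split; last by rewrite (leq_trans m_gt1) // leq_pmulr // prime_gt0.
      apply/negP => /primeP; apply/negP/primePn; right; exists r; last exact: dvdn_mull.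
      by rewrite prime_gt1 //= ltn_Pmull // prime_gt0.
    have [e3 r3] := P_alg_exists m_gt0.
    rewrite (IH _ lt1 _ (Mul e0 e3) r1); last first.
      rewrite En1; apply: (P_alg_div (p := p')); rewrite ?mulNP ?dvdn_mull //.
      by rewrite mulnK.
    rewrite (IH _ lt2 _ (Mul e e3) r2'); last first.
      rewrite En2; apply: (P_alg_div (p := p)); rewrite ?mulNP ?dvdn_mull //.
      by rewrite mulnK.
    by rewrite /= (shortest_ones se) (shortest_ones se') addnCA.
  by have := H0 _ pP; rewrite pn.
- inversion r2; subst => //.
  + by have := nd _ H; rewrite dvdnn.
  + by have := nd _ H1; rewrite H2.
  + by rewrite /= (IH _ _ _ _ r1 H1) // prednK // ltnW.
Qed.

Lemma P_complexity_spec n : 0 < n ->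
  (exists e, P_alg P n e) /\
  (forall e, P_alg P n e -> value e = n /\ ones e = P_complexity P n).
Proof.
move=> n_gt0; split; first exact: P_alg_exists.
move=> e ne; split; first exact: P_alg_value ne.
apply/esym/xget_unique; first by exists e.
by move=> k [e' ne' <-]; apply: P_alg_ones ne' ne.
Qed.

Lemma P_complexity1 : P_complexity P 1 = 1.
Proof.
have [_ H] := P_complexity_spec (ltn0Sn 0).
by have [_ <-] := H _ (P_alg_one P).
Qed.

Lemma P_complexity_mem p : p \in P -> P_complexity P p = complexity p.
Proof.
move=> pP; have p_gt0 := prime_gt0 (primeP pP).
have [e pe] := shortest_exists p_gt0; have [_ H] := P_complexity_spec p_gt0.
by have [_ <-] := H _ (P_alg_mem pP pe); apply: shortest_ones.
Qed.

Lemma P_complexity_div n p : 1 < n -> n \notin P -> p \in P -> p %| n ->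
  P_complexity P n = complexity p + P_complexity P (n %/ p).
Proof.
move=> n_gt1 nP pP pn; have p_gt0 := prime_gt0 (primeP pP).
have n_gt0 := ltnW n_gt1.
have np_gt0 : 0 < n %/ p by rewrite divn_gt0 // dvdn_leq.
have [e pe] := shortest_exists p_gt0.
have [[e' ne'] H'] := P_complexity_spec np_gt0.
have [_ H] := P_complexity_spec n_gt0.
have [_ <-] := H _ (P_alg_div n_gt1 nP pP pn pe ne').
by rewrite /= (shortest_ones pe); have [_ ->] := H' _ ne'.
Qed.

Lemma P_complexity_sub n : 1 < n -> (forall p, p \in P -> ~~ (p %| n)) ->
  P_complexity P n = 1 + P_complexity P n.-1.
Proof.
move=> n_gt1 nd; have n_gt0 := ltnW n_gt1.
have n1_gt0 : 0 < n.-1 by case: n n_gt1 {nd n_gt0} => [|[]].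
have [[e ne] H'] := P_complexity_spec n1_gt0.
have [_ H] := P_complexity_spec n_gt0.
have [_ <-] := H _ (P_alg_sub n_gt1 nd ne).
by have [_ /= ->] := H' _ ne.
Qed.

End WellDefined.

(* Main.v *)
(** Put [c := ||Q||_log + (q - 1) / log3 q].  A run of the algorithm alternates
    divisions by some [p \in P] with blocks of at most [q - 1] decrements, as a
    block stops at a multiple of [q] at the latest.  Dividing by [p] lowers
    [c * log3 n] by [c * log3 p], which pays for [||p||] and, since [q <= p],
    for [q - 1] decrements as well; amortizing these decrements over the block
    preceding the division gives an induction along the run.  The run may
    instead end below [q], at some [1 < m < q] and at cost [m]: then
    [m - 1 <= (q - 1) / log3 q * log3 m] by concavity, and the remaining [1] is
    at most [||Q||_log * log3 2], because [k] ones express less than [2 ^ k]. *)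
Require Import Defs.
From mathcomp Require Import all_boot all_order all_algebra finmap.
From mathcomp Require Import all_classical all_reals interval_inference.
From mathcomp Require Import convex exp.
From mathcomp Require Import zify lra.
Set Implicit Arguments.
Unset Strict Implicit.
Unset Printing Implicit Defensive.
Import Order.TTheory GRing.Theory Num.Theory.

Local Open Scope ring_scope.

Section Logarithm.
Variable R : realType.
Implicit Types x y : R.

Lemma line_path_ln_le x y z : 0 < x -> x < z -> x <= y <= z ->
  line_path (ln x) (ln z) (factor x z y) <= ln y.
Proof.
move=> x0 xz /andP[xy yz]; have z0 := lt_trans x0 xz.
have zx0 : 0 < z - x by rewrite subr_gt0.
have t0 : 0 <= factor x z y by rewrite divr_ge0 ?subr_ge0 // ltW.
have t1 : factor x z y <= 1 by rewrite ler_pdivrMr // mul1r lerD2r.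
have := concave_ln (Itv01 t0 t1) z0 x0; rewrite !convR_line_path /=.
by rewrite factorK // lt_eqF.
Qed.

Lemma log3_gt0 x : 1 < x -> 0 < log3 x.
Proof. by move=> x1; rewrite divr_gt0 ?ln_gt0 // ltr1n. Qed.

Lemma ler_log3 : {in Num.pos &, {mono @log3 R : x y / x <= y}}.
Proof.
by move=> x y x0 y0; rewrite ler_pM2r ?ler_ln // invr_gt0 ln_gt0 // ltr1n.
Qed.

Lemma log3M : {in Num.pos &, {morph @log3 R : x y / x * y >-> x + y}}.
Proof. by move=> x y x0 y0; rewrite /log3 lnM // mulrDl. Qed.

Lemma log3Xn n x : 0 < x -> log3 (x ^+ n) = log3 x *+ n.
Proof. by move=> x0; rewrite /log3 lnXn // mulrnAl. Qed.

Lemma log3_secant1 x y :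
  1 < y -> 1 <= x <= y -> (x - 1) * log3 y <= (y - 1) * log3 x.
Proof.
move=> y1 xy; have := line_path_ln_le ltr01 y1 xy.
rewrite line_pathEl ln1 subr0 addr0 mulrAC ler_pdivrMr ?subr_gt0 // => secant.
by rewrite !mulrA ler_pM2r ?[(y - 1) * _]mulrC // invr_gt0 ln_gt0 // ltr1n.
Qed.

Lemma log3_nat_gt0 (n : nat) : (1 < n)%N -> 0 < log3 n%:R :> R.
Proof. by rewrite -(ltr1n R); exact: log3_gt0. Qed.

Lemma ler_log3_nat (m n : nat) :
  (0 < m)%N -> (m <= n)%N -> log3 m%:R <= log3 n%:R :> R.
Proof.
by move=> m0 mn; rewrite ler_log3 ?ler_nat ?posrE ?ltr0n // (leq_trans m0).
Qed.

Lemma log3_nat_divn (d n : nat) : (0 < n)%N -> (d %| n)%N ->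
  log3 n%:R = log3 d%:R + log3 (n %/ d)%:R :> R.
Proof.
move=> n0 dn; have d0 := dvdn_gt0 n0 dn.
rewrite -log3M -?natrM ?[(d * _)%N]mulnC ?divnK // posrE ltr0n //.
by rewrite divn_gt0 // dvdn_leq.
Qed.

End Logarithm.

Lemma value_lt_exp2 (e : expr) : (value e < 2 ^ ones e)%N.
Proof.
elim: e => //= e1 IH1 e2 IH2; rewrite expnD; last exact: ltn_mul.
by have := leq_mul IH1 IH2; lia.
Qed.

Lemma log3_le_complexity (R : realType) (m : nat) : (0 < m)%N ->
  log3 m%:R <= (complexity m)%:R * log3 2 :> R.
Proof.
move=> m0; have [[e em ek] _] := complexity_spec m0.
rewrite mulr_natl -log3Xn // -natrX ler_log3_nat // -ek -em.
exact: ltnW (value_lt_exp2 e).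
Qed.

(* From [n >= q], at most [n %% q] of the [q - 1] decrements paid for by the
   next division are still to come; the others are the credit of [n].  Below
   [q] no division follows. *)
Definition credit (q n : nat) : nat :=
  (if n < q then 0 else q.-1 - n %% q)%N.

Lemma credit_le_pred (q n : nat) : (credit q n <= q.-1)%N.
Proof. by rewrite /credit; case: ifP => // _; exact: leq_subr. Qed.

Lemma credit_pred (q n : nat) : (0 < q)%N -> (q <= n)%N -> ~~ (q %| n)%N ->
  credit q n.-1 = (credit q n).+1.
Proof.
case: n => [|n] q0 qn ndvd; first by rewrite dvdn0 in ndvd.
have q_le_n : (q <= n)%N.
  by rewrite -ltnS ltn_neqAle qn andbT; apply: contraNneq ndvd => <-.
have := ltn_pmod n.+1 q0.
rewrite /credit /= !ltnNge qn q_le_n /= modnS (negPf ndvd).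
by lia.
Qed.

Section AmortizedBound.
Variables (R : realType) (P : {fset nat}) (q : nat) (division_rate : R).
Hypothesis P_prime : forall p : nat, p \in P -> prime p.
Hypothesis q_in : q \in P.
Hypothesis q_min : forall p : nat, p \in P -> (q <= p)%N.
Hypothesis complexity_le :
  forall p : nat, p \in P -> (complexity p)%:R <= division_rate * log3 p%:R.

Let q_gt1 : (1 < q)%N := prime_gt1 (P_prime q_in).

Let decrement_rate : R := (q%:R - 1) / log3 q%:R.

Lemma P_complexity_lt_min (n : nat) : (0 < n < q)%N -> P_complexity P n = n.
Proof.
elim: n => // -[|n] IH /andP[_ nq]; first exact: P_complexity1.
rewrite (P_complexity_sub P_prime) //= => [|p pP].
  by rewrite IH ?(ltnW nq).
by rewrite gtnNdvd // (leq_trans nq) // q_min.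
Qed.

Lemma le1_division_rate_log3_2 : 1 <= division_rate * log3 2.
Proof.
have log3_q_gt0 : 0 < log3 q%:R :> R := log3_nat_gt0 R q_gt1.
rewrite -(ler_pM2r log3_q_gt0) mul1r mulrAC.
apply: le_trans (log3_le_complexity R (ltnW q_gt1)) _.
by rewrite ler_wpM2r ?complexity_le // ltW // log3_nat_gt0.
Qed.

Lemma division_rate_ge0 : 0 <= division_rate.
Proof.
have log3_2_gt0 : 0 < log3 2 :> R := log3_nat_gt0 R (isT : 1 < 2)%N.
by rewrite -(pmulr_lge0 _ log3_2_gt0); apply: le_trans le1_division_rate_log3_2.
Qed.

Lemma decrement_rate_ge0 : 0 <= decrement_rate.
Proof. by rewrite divr_ge0 ?ltW ?log3_nat_gt0 // subr_gt0 ltr1n. Qed.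

Lemma total_rate_ge0 : 0 <= division_rate + decrement_rate.
Proof. exact: addr_ge0 division_rate_ge0 decrement_rate_ge0. Qed.

Lemma credit_le_log3 (n p : nat) : p \in P ->
  (credit q n)%:R <= decrement_rate * log3 p%:R.
Proof.
move=> pP; apply: (@le_trans _ _ (q%:R - 1)).
  by rewrite lerBrDr natr1 ler_nat -(prednK (ltnW q_gt1)) ltnS credit_le_pred.
have <- : decrement_rate * log3 q%:R = q%:R - 1.
  by rewrite divfK // gt_eqF // log3_nat_gt0.
by rewrite ler_wpM2l ?decrement_rate_ge0 // ler_log3_nat ?q_min // ltnW.
Qed.

Lemma P_complexity_lt_min_le_log3 (n : nat) : (1 < n < q)%N ->
  (P_complexity P n)%:R <= (division_rate + decrement_rate) * log3 n%:R.
Proof.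
move=> /andP[n1 nq]; rewrite P_complexity_lt_min ?(ltnW n1) // mulrDl.
have last_one : 1 <= division_rate * log3 n%:R.
  apply: le_trans le1_division_rate_log3_2 _.
  by rewrite ler_wpM2l ?division_rate_ge0 // ler_log3_nat.
have decrements : n%:R - 1 <= decrement_rate * log3 n%:R.
  rewrite mulrAC ler_pdivlMr ?log3_nat_gt0 //.
  by rewrite log3_secant1 ?ltr1n // ler1n ler_nat (ltnW n1) ltnW.
lra.
Qed.

Lemma P_complexity_credit_le (n : nat) : (1 < n)%N ->
  (P_complexity P n + credit q n)%:R <=
    (division_rate + decrement_rate) * log3 n%:R.
Proof.
elim/ltn_ind: n => n IH n1; have n0 := ltnW n1.
have [nq|qn] := ltnP n q.
  by rewrite /credit nq addn0 P_complexity_lt_min_le_log3 ?n1.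
have [nP|nNP] := boolP (n \in P).
  rewrite P_complexity_mem // natrD mulrDl.
  by rewrite lerD ?complexity_le ?credit_le_log3.
have [[p [pP pn]]|ndvd] := pselect (exists p, p \in P /\ (p %| n)%N).
  have m1 : (1 < n %/ p)%N.
    rewrite ltn_divRL // mul1n ltn_neqAle dvdn_leq // andbT.
    by apply: contraNneq nNP => <-.
  have quotient_cost := IH _ (ltn_Pdiv (prime_gt1 (P_prime pP)) n0) m1.
  have p_cost := complexity_le pP; have credit_cost := credit_le_log3 n pP.
  have quotient_credit := ler0n R (credit q (n %/ p)).
  rewrite (P_complexity_div P_prime n1 nNP pP pn) (log3_nat_divn R n0 pn).
  by rewrite !natrD in quotient_cost *; lra.
have {}ndvd p : p \in P -> ~~ (p %| n)%N.
  by move=> pP; apply/negP => pn; apply: ndvd; exists p.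
have q_lt_n : (q < n)%N.
  by rewrite ltn_neqAle qn andbT; apply: contraNneq nNP => <-.
have pred_n_gt1 : (1 < n.-1)%N by lia.
rewrite (P_complexity_sub P_prime n1 ndvd) addnC addnA addn1.
rewrite -(credit_pred (ltnW q_gt1) qn (ndvd q q_in)) addnC.
apply: le_trans (IH n.-1 _ pred_n_gt1) _; first by rewrite prednK.
by rewrite ler_wpM2l ?total_rate_ge0 // ler_log3_nat ?leq_pred // ltnW.
Qed.

Lemma P_complexity_le_log3 (n : nat) : (1 < n)%N ->
  (P_complexity P n)%:R <= (division_rate + decrement_rate) * log3 n%:R.
Proof.
move=> n1; apply: le_trans (P_complexity_credit_le n1).
by rewrite ler_nat leq_addr.
Qed.

End AmortizedBound.

Theorem theorem3 (R : realType) (P : {fset nat}) (q Q : nat)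
  (P_neq0 : P <> fset0)
  (P_prime : forall p : nat, p \in P -> prime p)
  (q_in : q \in P)
  (q_min : forall p : nat, p \in P -> (q <= p)%N)
  (Q_in : Q \in P)
  (Q_max : forall p : nat, p \in P ->
     (complexity_log R p <= complexity_log R Q)%R)
  (n : nat) (n_gt1 : (1 < n)%N) :
  (P_complexity_log R P n
     <= complexity_log R Q + (q%:R - 1) / log3 q%:R)%R.
Proof.
rewrite /P_complexity_log ler_pdivrMr ?log3_nat_gt0 //.
apply: P_complexity_le_log3 => // p pP.
by rewrite -ler_pdivrMr ?log3_nat_gt0 ?prime_gt1 ?P_prime //; exact: Q_max.
Qed.
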